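(* For every finite ordered set $P$ let ${\rm Aut}(P)$ denote its set of automorphisms and ${\rm End}(P)$ its set of endomorphisms (order-preserving self-maps). Then $$\lim_{n\to\infty}\ \max\left\{ \frac{|{\rm Aut}(P)|}{|{\rm End}(P)|} \ :\ P \text{ a finite ordered set of width at most } 9,\ |P|=n\right\}=0 .$$ That is, the Automorphism Conjecture holds for the class of finite ordered sets of width at most $9$.
   Context: The width of an ordered set is the size of its largest antichain (set of pairwise incomparable elements). An automorphism is an order-preserving bijection whose inverse is also order-preserving. *)

(* Defs.v *)
From HB Require Import structures.
From mathcomp Require Import all_boot all_order all_fingroup all_algebra.
From mathcomp Require Import all_classical all_reals all_analysis.

Set Implicit Arguments.
Unset Strict Implicit.
Unset Printing Implicit Defensive.

Import Order.TTheory GRing.Theory Num.Theory.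

Section FinitePosets.
Variables (d : Order.disp_t) (P : finPOrderType d).

Definition antichain (A : {set P}) : bool :=
  [forall x in A, forall y in A, (x != y) ==> (x >< y)%O].

Definition width : nat := \max_(A : {set P} | antichain A) #|A|.

Definition order_preserving (f : P -> P) : bool :=
  [forall x, forall y, (x <= y)%O ==> (f x <= f y)%O].

Definition poset_end : {set {ffun P -> P}} :=
  [set f : {ffun P -> P} | order_preserving f].

Definition poset_aut : {set {perm P}} :=
  [set s : {perm P} | order_preserving s && order_preserving (s^-1)%g].

End FinitePosets.

Section Ratios.
Variable R : realType.
Local Open Scope classical_set_scope.
Local Open Scope ring_scope.

Definition aut_end_ratio (d : Order.disp_t) (P : finPOrderType d) : R :=
  #|poset_aut P|%:R / #|poset_end P|%:R.

Definition aut_end_ratios (w n : nat) : set R :=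
  [set r | exists (d : Order.disp_t) (P : finPOrderType d),
     [/\ (width P <= w)%N, #|P| = n & r = aut_end_ratio P]].

Definition is_max (A : set R) (m : R) : Prop := A m /\ ubound A m.

End Ratios.

Arguments aut_end_ratio R {d} P.
Arguments aut_end_ratios : clear implicits.

(* Main.v *)
Require Import Defs.
From mathcomp Require Import all_boot all_order all_fingroup all_algebra.
From mathcomp Require Import zify.

(** Bound the order of a subgroup [H] of [Aut P] by fixing one point [x] at a
    time.  If the [H]-orbit [X] of [x] is linked to another orbit [Y], meaning
    that some point of [X] is comparable in one direction to some but not all
    of [Y], then fixing [x] costs a factor [#|X|] but also splits [Y].  Taking
    [#|X| <= #|Y|] and sharing the cost equally between [X] and [Y] yields
    [#|H| <= \prod_O sqrt (#|O|`!)] over the orbits [O] of [H], as long as no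
    orbit is isolated.  Since [8`! < 4 ^ 8] this beats [2 ^ n], and a lower
    bound [2 ^ (n - 9)] for [#|End P|] comes from the maps
    [x |-> c (lev x + [x \in A])] into a maximal chain [c].  For orbits of size
    9, where [9`!] slightly exceeds [4 ^ 9], a smaller weight works unless [P]
    contains two 9-element orbits that are linked only to each other.

    The two obstructions, isolated orbits (which consist of twins) and such
    pairs of orbits, are [Aut P]-invariant sets of at most 18 points that can
    be collapsed by an endomorphism fixing all other points.  If there are many
    disjoint sets of this kind, composing automorphisms with the collapses
    gives many more endomorphisms than automorphisms; if there are few, fixing
    them pointwise costs only a bounded factor. *)

Set Implicit Arguments.
Unset Strict Implicit.
Unset Printing Implicit Defensive.

Import Order.TTheory.

(** * Orbit weights *)

(* The value at 9 must be below [4 ^ 9], which [9`!] is not, and still above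
   [6 * 8`!] for the splitting inequalities below; [63 * 2 ^ 12] is
   [63 / 64 * 4 ^ 9]. *)
Definition orbit_weight (k : nat) : nat :=
  if k == 9 then 63 * 2 ^ 12 else k`!.

Ltac weight_compute :=
  rewrite /orbit_weight ?subSS ?subn0 /= ?factS ?fact0 ?expnS ?expn0; lia.

Lemma orbit_weight_gt0 k : 0 < orbit_weight k.
Proof. by rewrite /orbit_weight; case: ifP => // _; exact: fact_gt0. Qed.

Lemma orbit_weight_le_fact k : orbit_weight k <= k`!.
Proof. by rewrite /orbit_weight; case: eqP => // ->; weight_compute. Qed.

(** Up to 8 the weights are factorials, and the binomial coefficient of [k] over [j] is at least [k]
    for [0 < j < k]. *)
Lemma orbit_weight_split_le8 j k : 0 < j < k -> k <= 8 ->
  k * (orbit_weight j * orbit_weight (k - j)) <= orbit_weight k.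
Proof.
do 9! [case: k => [|k]; first by do 9! [case: j => [|j] //] => _ _; weight_compute].
by case: j => [|j] //; lia.
Qed.

(** The worst cases are [j = 1] and [j = 8], with quotient [32 / 5]. *)
Lemma orbit_weight_split9 j : 0 < j < 9 ->
  6 * (orbit_weight j * orbit_weight (9 - j)) <= orbit_weight 9.
Proof. by do 9! [case: j => [|j] //] => _; weight_compute. Qed.

(** Without the two extreme splittings the worst quotient is 25.6, at [j = 2] and [j = 7]. *)
Lemma orbit_weight_split9_proper j : 1 < j < 8 ->
  25 * (orbit_weight j * orbit_weight (9 - j)) <= orbit_weight 9.
Proof. by do 9! [case: j => [|j] //] => _; weight_compute. Qed.

Lemma orbit_weightD j k :
  orbit_weight j * orbit_weight k <= orbit_weight (j + k).
Proof.
have [jk9|jk9] := eqVneq (j + k) 9.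
  have [j0|j0] := posnP j; first by move: jk9; rewrite j0 add0n => ->; weight_compute.
  have [k0|k0] := posnP k; first by move: jk9; rewrite k0 addn0 => ->; weight_compute.
  have kE : k = 9 - j by lia.
  have j9 : 0 < j < 9 by lia.
  by have := orbit_weight_split9 j9; rewrite jk9 -kE; lia.
rewrite {3}/orbit_weight (negbTE jk9).
apply: leq_trans (leq_mul (orbit_weight_le_fact _) (orbit_weight_le_fact _)) _.
by rewrite -(bin_fact (leq_addr k j)) addKn leq_pmull // bin_gt0 leq_addr.
Qed.

Lemma orbit_weight_sum (I : finType) (A : pred I) (F : I -> nat) :
  \prod_(i | A i) orbit_weight (F i) <= orbit_weight (\sum_(i | A i) F i).
Proof.
elim/big_rec2: _ => // i y1 y2 _ /(leq_mul (leqnn (orbit_weight (F i)))) le12.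
exact: leq_trans le12 (orbit_weightD _ _).
Qed.

(** Equality holds at 9. The factor [63 / 64] gained by every orbit makes the ratio decay in the
    end. *)
Lemma orbit_weight_le_pow4 k : 0 < k <= 9 ->
  64 * orbit_weight k <= 63 * 4 ^ k.
Proof.
case: k => // k.
rewrite /orbit_weight.
do 9! (case: k => [|k]; [by move=> _; weight_compute|]).
done.
Qed.

Lemma orbit_weight_pred k : 0 < k <= 8 -> k * orbit_weight k.-1 = orbit_weight k.
Proof. by do 9! [case: k => [|k] //] => _; weight_compute. Qed.

Lemma orbit_weight_ratio98 : 32 * orbit_weight 8 = 5 * orbit_weight 9.
Proof. by weight_compute. Qed.

(* Prevents conversion from computing [8`!] in unary. *)
Opaque orbit_weight.

(** Here [x] and [y] are orbit sizes: the squared index [x ^ 2] is paid for by the loss of one point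
    in the first orbit and the splitting of the second. In the excluded case [y = 9], [x >= 7], [j]
    equal to 1 or 8, the splitting gains only [32 / 5] and the inequality fails. *)
Lemma orbit_weight_pair x y j : 0 < x <= y -> y <= 9 -> 0 < j < y ->
    [|| y <= 8, x <= 6 | 1 < j < 8] ->
  x ^ 2 * (orbit_weight x.-1 * (orbit_weight j * orbit_weight (y - j)))
    <= orbit_weight x * orbit_weight y.
Proof.
move=> /andP[x0 xy] y9 jy side.
have [x9|x8] := eqVneq x 9.
  have yE : y = 9 by lia.
  rewrite x9 yE in side *; have := @orbit_weight_split9_proper j side.
  have : 6 * orbit_weight 8 <= orbit_weight 9 by have := orbit_weight_ratio98; lia.
  by move=> le8 lej; apply: leq_trans (leq_mul le8 lej); rewrite mulnACA leq_mul.
rewrite expnS expn1 mulnACA orbit_weight_pred; last by lia.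
rewrite leq_mul //.
have [y8|y8] := leqP y 8.
  apply: leq_trans (orbit_weight_split_le8 jy y8).
  by rewrite leq_mul.
have {y8 y9}yE : y = 9 by lia.
rewrite yE in jy side *.
have [x6|x6] := leqP x 6.
  by apply: leq_trans (orbit_weight_split9 jy); rewrite leq_mul.
have {}side : 1 < j < 8 by move: side; rewrite (leqNgt x 6) x6.
by apply: leq_trans (orbit_weight_split9_proper side); rewrite leq_mul //; lia.
Qed.

Lemma orbit_weight_split_double j k : 0 < j < k -> k <= 9 ->
  2 * (orbit_weight j * orbit_weight (k - j)) <= orbit_weight k.
Proof.
move=> jk k9; have [k8|k8] := leqP k 8.
  by apply: leq_trans (orbit_weight_split_le8 jk k8); rewrite leq_mul //; lia.
have kE : k = 9 by lia.
by rewrite kE in jk *; apply: leq_trans (orbit_weight_split9 jk); rewrite leq_mul.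
Qed.

(** Two 9-point orbits that each lose a point gain [(32 / 5) ^ 2 = 40.96], just over half of
    [9 ^ 2]; splitting a third orbit supplies the missing factor 2. *)
Lemma orbit_weight_triple j k : 0 < j < k -> k <= 9 ->
  9 ^ 2 * (orbit_weight 8 * (orbit_weight 8 * (orbit_weight j * orbit_weight (k - j))))
    <= orbit_weight 9 * (orbit_weight 9 * orbit_weight k).
Proof.
move=> jk k9; have := orbit_weight_split_double jk k9.
have [m [-> ->]] : exists m, orbit_weight 8 = 5 * m /\ orbit_weight 9 = 32 * m.
  by exists (orbit_weight 8 %/ 5); have := orbit_weight_ratio98; lia.
move=> /(leq_mul (leqnn (1024 * (m * m)))); rewrite mulnA => split_le.
apply: leq_trans (leq_trans _ split_le) _; last by rewrite mulnACA mulnA; lia.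
by rewrite expnS expn1; nia.
Qed.

Lemma card_le_fiber (aT rT : finType) (f : aT -> rT) (A : {set aT}) (c : nat) :
  (forall a, a \in A -> #|[set b in A | f b == f a]| <= c) ->
  #|A| <= c * #|f @: A|.
Proof.
move=> fib; rewrite -sum1_card (partition_big_imset f) /= mulnC -sum_nat_const.
by apply: leq_sum => y /imsetP[a Aa ->]; rewrite sum1dep_card fib.
Qed.

(** * Weight products over orbits, and their change on passing to a point stabilizer *)

Section OrbitsWeight.
Variable T : finType.
Implicit Types (H K : {group {perm T}}) (A B : {set T}) (x y z : T).

(** To avoid square roots, this product is compared with [#|H| ^ 2]. *)
Definition orbits_weight (H : {set {perm T}}) (A : {set T}) : nat :=
  \prod_(O in orbit 'P H @: A) orbit_weight #|O|.

Lemma mem_orbit_perm H x h : h \in H -> h x \in orbit 'P H x.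
Proof. by move=> Hh; apply/orbitP; exists h. Qed.

Lemma acts_perm H A :
  (forall h a, h \in H -> a \in A -> h a \in A) -> [acts H, on A | 'P].
Proof.
move=> clA; apply/actsP => h Hh a /=; rewrite apermE; apply/idP/idP => [hA|]; last exact: clA.
by rewrite -[a](permK h) clA ?groupV.
Qed.

Lemma acts_perm_sub H K A : K \subset H -> [acts H, on A | 'P] -> [acts K, on A | 'P].
Proof. exact: subset_trans. Qed.

Lemma acts_perm_orbit H x : [acts H, on orbit 'P H x | 'P].
Proof.
by apply: acts_perm => h a Hh /orbit_eqP <-; apply: mem_orbit_perm.
Qed.

Lemma acts_permD H A B :
  [acts H, on A | 'P] -> [acts H, on B | 'P] -> [acts H, on A :\: B | 'P].
Proof.
move=> /actsP HA /actsP HB; apply: acts_perm => h a Hh.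
by rewrite !inE -!apermE HA ?HB.
Qed.

Lemma orbits_weight_gt0 H A : 0 < orbits_weight H A.
Proof. by apply: prodn_cond_gt0 => *; exact: orbit_weight_gt0. Qed.

Lemma orbits_weight_le H A :
  [acts H, on A | 'P] -> orbits_weight H A <= orbit_weight #|A|.
Proof.
move=> HA; rewrite (card_partition (orbit_partition HA)).
exact: orbit_weight_sum.
Qed.

Lemma orbits_weight_split H A B : [acts H, on A | 'P] -> [acts H, on B | 'P] ->
    A \subset B ->
  orbits_weight H B <= orbit_weight #|A| * orbit_weight (#|B| - #|A|).
Proof.
move=> HA HB AB; rewrite -(setIidPr AB) -cardsD (setIidPr AB).
have -> : orbits_weight H B = orbits_weight H A * orbits_weight H (B :\: A).
  rewrite /orbits_weight (bigID (fun O : {set T} => O \subset A)) /=.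
  congr (_ * _); apply: eq_bigl => O; apply/andP/imsetP.
  - move=> [/imsetP[x Bx ->]]; rewrite acts_sub_orbit // => Ax.
    by exists x.
  - move=> [x Ax ->]; split; last by rewrite acts_sub_orbit.
    by apply/imsetP; exists x => //; apply: (subsetP AB).
  - move=> [/imsetP[x Bx ->]]; rewrite acts_sub_orbit // => Ax.
    by exists x => //; rewrite inE Ax.
  - move=> [x /setDP[Bx Ax] ->]; split; last by rewrite acts_sub_orbit.
    by apply/imsetP; exists x.
by rewrite leq_mul // orbits_weight_le // acts_permD.
Qed.

Lemma orbits_weight_refine H K : K \subset H ->
  orbits_weight K [set: T] = \prod_(O in orbit 'P H @: [set: T]) orbits_weight K O.
Proof.
(* The hull of a [K]-orbit is the [H]-orbit containing it; the product over [K]-orbits is regrouped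
   by hulls. *)
move=> KH; pose hull (O : {set T}) := [set y | [exists x in O, y \in orbit 'P H x]].
have hullE x : hull (orbit 'P K x) = orbit 'P H x.
  apply/setP => y; rewrite inE; apply/exists_inP/idP => [[z]|xy]; last by exists x => //; exact: orbit_refl.
  move=> /orbitP[k Kk <-]; have /orbit_eqP -> // : aperm x k \in orbit 'P H x.
  by apply: mem_orbit_perm; apply: (subsetP KH).
rewrite /orbits_weight (partition_big hull [in orbit 'P H @: [set: T]]) /=; last first.
  by move=> O /imsetP[x _ ->]; rewrite hullE; apply: imset_f; rewrite inE.
apply: eq_bigr => O /imsetP[z _ ->]; apply: eq_bigl => Q; apply/andP/imsetP.
  move=> [/imsetP[x _ ->]]; rewrite hullE => /eqP xz; exists x => //.
  by apply/orbit_eqP.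
by move=> [x /orbit_eqP xz ->]; rewrite hullE xz imset_f ?inE.
Qed.

Lemma orbits_weight_refine_le H K A : K \subset H -> A \in orbit 'P H @: [set: T] ->
  orbits_weight K A <= orbit_weight #|A|.
Proof.
move=> KH /imsetP[x _ ->]; apply: orbits_weight_le.
exact: acts_perm_sub KH (acts_perm_orbit H x).
Qed.

Lemma orbits_weight_point K x X : [acts K, on X | 'P] -> x \in X ->
  (forall k, k \in K -> k x = x) ->
  orbits_weight K X <= orbit_weight #|X|.-1.
Proof.
move=> KX Xx Kx; rewrite -[orbit_weight _]mul1n.
have := @orbits_weight_split K [set x] X; rewrite cards1 subn1; apply=> //.
  by apply: acts_perm => k a Kk /set1P->; rewrite Kx // inE.
by rewrite sub1set.
Qed.

Lemma card_orbit_stab_perm H x :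
  (#|orbit 'P H x| * #|'C_H[x | 'P]%g|)%N = #|H|.
Proof. exact: card_orbit_stab. Qed.

Lemma stab_fix H x k : k \in 'C_H[x | 'P]%g -> k x = x.
Proof. by move=> /setIP[_ /astab1P]. Qed.

(** Induction step: passing to [K] costs [#|X| ^ 2] by orbit-stabilizer, is repaid by the factors of
    [X] and [Y], and cannot increase the factor of any other orbit. *)
Lemma pair_step H x y A (K := 'C_H[x | 'P]%g) (X := orbit 'P H x) (Y := orbit 'P H y) :
    X != Y -> [acts K, on A | 'P] -> A \subset Y ->
    #|X| ^ 2 * (orbit_weight #|X|.-1 * (orbit_weight #|A| * orbit_weight (#|Y| - #|A|)))
      <= orbit_weight #|X| * orbit_weight #|Y| ->
    #|K| ^ 2 <= orbits_weight K [set: T] ->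
  #|H| ^ 2 <= orbits_weight H [set: T].
Proof.
move=> XY KA AY le_pair leK.
have KH : K \subset H by exact: subsetIl.
rewrite -(card_orbit_stab_perm H x) -/X expnMn; move: (#|X| ^ 2) le_pair => c le_pair.
apply: leq_trans (leq_mul (leqnn _) leK) _.
rewrite (orbits_weight_refine KH) {2}/orbits_weight.
have oX : X \in orbit 'P H @: [set: T] by rewrite imset_f ?inE.
have oY : Y \in orbit 'P H @: [set: T] by rewrite imset_f ?inE.
have prodE (F : {set T} -> nat) : \prod_(O in orbit 'P H @: [set: T]) F O =
    F X * F Y * \prod_(O in orbit 'P H @: [set: T] | (O != X) && (O != Y)) F O.
  rewrite (bigD1 X) //= (bigD1 Y) ?oY 1?eq_sym //= mulnA.
  by congr (_ * _); apply: eq_bigl => O; rewrite andbA.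
rewrite !prodE !mulnA leq_mul //; last first.
  by apply: leq_prod => O /andP[oO _]; exact: orbits_weight_refine_le KH oO.
have leX : orbits_weight K X <= orbit_weight #|X|.-1.
  apply: (@orbits_weight_point _ x _); rewrite ?orbit_refl //; last by move=> k; apply: stab_fix.
  exact: acts_perm_sub KH (acts_perm_orbit H x).
have leY : orbits_weight K Y <= orbit_weight #|A| * orbit_weight (#|Y| - #|A|).
  by apply: orbits_weight_split => //; exact: acts_perm_sub KH (acts_perm_orbit H y).
apply: leq_trans _ le_pair; rewrite -!mulnA leq_mul2l; apply/orP; right.
exact: leq_mul leX leY.
Qed.

(** As in [pair_step], but fixing [x] also fixes [y], so [Y] loses a point at no further cost. *)
Lemma triple_step H x y z A (K := 'C_H[x | 'P]%g) (X := orbit 'P H x)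
    (Y := orbit 'P H y) (Z := orbit 'P H z) :
    X != Y -> X != Z -> Y != Z -> (forall k, k \in K -> k y = y) ->
    [acts K, on A | 'P] -> A \subset Z ->
    #|X| ^ 2 * (orbit_weight #|X|.-1 * (orbit_weight #|Y|.-1 *
        (orbit_weight #|A| * orbit_weight (#|Z| - #|A|))))
      <= orbit_weight #|X| * (orbit_weight #|Y| * orbit_weight #|Z|) ->
    #|K| ^ 2 <= orbits_weight K [set: T] ->
  #|H| ^ 2 <= orbits_weight H [set: T].
Proof.
move=> XY XZ YZ Ky KA AZ le_triple leK.
have KH : K \subset H by exact: subsetIl.
rewrite -(card_orbit_stab_perm H x) -/X expnMn; move: (#|X| ^ 2) le_triple => c le_triple.
apply: leq_trans (leq_mul (leqnn _) leK) _.
rewrite (orbits_weight_refine KH) {2}/orbits_weight.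
have oX : X \in orbit 'P H @: [set: T] by rewrite imset_f ?inE.
have oY : Y \in orbit 'P H @: [set: T] by rewrite imset_f ?inE.
have oZ : Z \in orbit 'P H @: [set: T] by rewrite imset_f ?inE.
have prodE (F : {set T} -> nat) : \prod_(O in orbit 'P H @: [set: T]) F O =
    F X * F Y * F Z *
      \prod_(O in orbit 'P H @: [set: T] | [&& O != X, O != Y & O != Z]) F O.
  rewrite (bigD1 X) //= (bigD1 Y) ?oY 1?eq_sym //= (bigD1 Z) ?oZ ?(eq_sym Z) ?XZ //= !mulnA.
  by congr (_ * _); apply: eq_bigl => O; rewrite !andbA.
rewrite !prodE !mulnA leq_mul //; last first.
  by apply: leq_prod => O /andP[oO _]; exact: orbits_weight_refine_le KH oO.
have leX : orbits_weight K X <= orbit_weight #|X|.-1.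
  apply: (@orbits_weight_point _ x _); rewrite ?orbit_refl //; last by move=> k; apply: stab_fix.
  exact: acts_perm_sub KH (acts_perm_orbit H x).
have leY : orbits_weight K Y <= orbit_weight #|Y|.-1.
  apply: (@orbits_weight_point _ y _); rewrite ?orbit_refl //.
  exact: acts_perm_sub KH (acts_perm_orbit H y).
have leZ : orbits_weight K Z <= orbit_weight #|A| * orbit_weight (#|Z| - #|A|).
  by apply: orbits_weight_split => //; exact: acts_perm_sub KH (acts_perm_orbit H z).
rewrite -!mulnA; apply: leq_trans _ le_triple; rewrite leq_mul2l; apply/orP; right.
exact: leq_mul leX (leq_mul leY leZ).
Qed.

End OrbitsWeight.

(** * Collapsible sets *)

Section Automorphisms.
Variables (d : Order.disp_t) (P : finPOrderType d).
Implicit Types (x y z p q a b : P) (A B X Y Z : {set P}) (g h k : {perm P})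
  (H K : {group {perm P}}).

Lemma poset_autP g : reflect {mono g : x y / (x <= y)%O} (g \in poset_aut P).
Proof.
rewrite inE; apply: (iffP andP) => [[/forallP gle /forallP gVle] x y|mg].
  apply/idP/idP => [le_g|]; last by have /forallP/(_ y)/implyP := gle x.
  by have /forallP/(_ (g y))/implyP/(_ le_g) := gVle (g x); rewrite !permK.
split; apply/forallP => x; apply/forallP => y; apply/implyP; first by rewrite mg.
by rewrite -(mg ((g^-1)%g x) ((g^-1)%g y)) !permKV.
Qed.

Lemma poset_aut_group_set : group_set (poset_aut P).
Proof.
apply/group_setP; split; first by apply/poset_autP => x y; rewrite !perm1.
move=> g h /poset_autP mg /poset_autP mh; apply/poset_autP => x y.
by rewrite !permM mh mg.
Qed.
Canonical poset_aut_group := Group poset_aut_group_set.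

Lemma poset_aut_lt g : g \in poset_aut P -> {mono g : x y / (x < y)%O}.
Proof.
by move=> /poset_autP mg x y; rewrite !lt_neqAle mg (inj_eq perm_inj).
Qed.

(** If [a < g a], then iterating gives [a < (g ^+ n) a] for all positive [n], which is absurd when
    [n] is the order of [g]. *)
Lemma orbit_aut_not_lt x a b :
  a \in orbit 'P (poset_aut P) x -> b \in orbit 'P (poset_aut P) x -> ~~ (a < b)%O.
Proof.
move=> /orbit_eqP ax; rewrite -ax => /orbitP[g Gg <-] {b}.
apply/negP; rewrite /= apermE => lt_ag.
have lt_agn n : (a < (g ^+ n.+1)%g a)%O.
  elim: n => [|n IHn]; first by rewrite expg1.
  apply: lt_trans lt_ag _; rewrite expgSr permM.
  by rewrite (poset_aut_lt Gg).
have := lt_agn #[g]%g.-1; rewrite prednK ?order_gt0 // expg_order perm1.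
by rewrite ltxx.
Qed.

Lemma card_antichain A : {in A &, forall a b, ~~ (a < b)%O} -> #|A| <= width P.
Proof.
move=> antiA; apply: (leq_bigmax_cond (F := fun A : {set P} => #|A|)).
apply/forall_inP => a Aa; apply/forall_inP => b Ab; apply/implyP => ab.
by rewrite /Order.comparable !le_eqVlt (negbTE ab) eq_sym (negbTE ab) !(negbTE (antiA _ _ _ _)).
Qed.

Lemma card_orbit_aut x : #|orbit 'P (poset_aut P) x| <= width P.
Proof. by apply: card_antichain => a b; apply: orbit_aut_not_lt. Qed.

Lemma orbit_aut_sub H x : H \subset poset_aut P ->
  orbit 'P H x \subset orbit 'P (poset_aut P) x.
Proof. by move=> HG; apply: imsetS. Qed.

(** The negation of being linked to [A]. With strict comparisons, every point of an antichain is
    uniform on it. *)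
Definition uniform p A :=
  [forall a in A, forall b in A, ((p < a)%O == (p < b)%O) && ((a < p)%O == (b < p)%O)].

Lemma uniformP p A :
  reflect {in A &, forall a b, (p < a)%O = (p < b)%O /\ (a < p)%O = (b < p)%O} (uniform p A).
Proof.
apply: (iffP forall_inP) => [unif a b Aa Ab|unif a Aa].
  by have /forall_inP/(_ b Ab)/andP[/eqP-> /eqP->] := unif a Aa.
by apply/forall_inP => b Ab; have [-> ->] := unif a b Aa Ab; rewrite !eqxx.
Qed.

Lemma nonuniformP p A :
  reflect (exists a b, [/\ a \in A, b \in A &
      (p < a)%O && ~~ (p < b)%O || (a < p)%O && ~~ (b < p)%O]) (~~ uniform p A).
Proof.
apply: (iffP idP) => [|[a [b [Aa Ab]]]]; last first.
  by case: (boolP (uniform p A)) => // /uniformP/(_ a b Aa Ab)[-> ->]; rewrite !andbN.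
rewrite negb_forall_in => /exists_inP[a Aa]; rewrite negb_forall_in => /exists_inP[b Ab].
move: (erefl (p < a)%O) (erefl (p < b)%O) (erefl (a < p)%O) (erefl (b < p)%O).
case: {2 3}(p < a)%O => pa; case: {2 3}(p < b)%O => pb; case: {2 3}(a < p)%O => ap;
  case: {2 3}(b < p)%O => bp //= _.
all: try by exists a, b; rewrite Aa Ab pa pb ap bp.
all: by exists b, a; rewrite Aa Ab pa pb ap bp.
Qed.

Lemma uniform_antichain p A : {in A &, forall a b, ~~ (a < b)%O} -> p \in A -> uniform p A.
Proof.
move=> antiA Ap; apply/uniformP => a b Aa Ab.
by rewrite !(negbTE (antiA _ _ _ _)).
Qed.

(** The points of [A] above [p], or those below [p], form the required part; it is invariant because
    [K] fixes [p]. *)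
Lemma uniform_split K p A : K \subset poset_aut P -> (forall k, k \in K -> k p = p) ->
    [acts K, on A | 'P] -> ~~ uniform p A ->
  exists B, [/\ B \subset A, [acts K, on B | 'P] & 0 < #|B| < #|A|].
Proof.
move=> KG Kp /actsP KA /nonuniformP[a [b [Aa Ab /orP[]/andP[pa pb]]]].
  exists [set c in A | (p < c)%O]; split.
  - by apply/subsetP => c; rewrite inE => /andP[].
  - apply: acts_perm => k c Kk; rewrite !inE -apermE KA // => /andP[-> pc] /=.
    by rewrite -[X in (X < _)%O](Kp k Kk) apermE (poset_aut_lt (subsetP KG k Kk)).
  apply/andP; split; first by apply/card_gt0P; exists a; rewrite inE Aa.
  apply: proper_card; apply/properP; split; first by apply/subsetP => c; rewrite inE => /andP[].
  by exists b; rewrite ?inE ?Ab.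
exists [set c in A | (c < p)%O]; split.
- by apply/subsetP => c; rewrite inE => /andP[].
- apply: acts_perm => k c Kk; rewrite !inE -apermE KA // => /andP[-> pc] /=.
  by rewrite -[X in (_ < X)%O](Kp k Kk) apermE (poset_aut_lt (subsetP KG k Kk)).
apply/andP; split; first by apply/card_gt0P; exists a; rewrite inE Aa.
apply: proper_card; apply/properP; split; first by apply/subsetP => c; rewrite inE => /andP[].
by exists b; rewrite ?inE ?Ab.
Qed.

Lemma uniform_aut H g p A : H \subset poset_aut P -> [acts H, on A | 'P] -> g \in H ->
  uniform (g p) A -> uniform p A.
Proof.
move=> HG /actsP HA Hg /uniformP unif; apply/uniformP => a b Aa Ab.
have ltE := poset_aut_lt (subsetP HG g Hg).
rewrite -(ltE p a) -(ltE p b) -(ltE a p) -(ltE b p).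
by apply: unif; rewrite -apermE HA.
Qed.

(** If [q] distinguishes [a] from [b = g a], then [b] distinguishes [g q] from [q]; an [h] taking
    [b] to [p] transports this to [p]. *)
Lemma uniform_orbit_sym H p q : H \subset poset_aut P ->
  uniform p (orbit 'P H q) -> uniform q (orbit 'P H p).
Proof.
move=> HG; apply: contraTT => /nonuniformP[a [b [pa pb ab]]].
have [g Hg gab] : exists2 g, g \in H & g a = b.
  by move/orbit_eqP: pa pb => <- /orbitP[g Hg <-]; exists g.
have [h Hh hb] : exists2 h, h \in H & h b = p.
  by move: pb; rewrite orbit_sym => /orbitP[h Hh <-]; exists h.
have ltE := fun g Hg => poset_aut_lt (subsetP HG g Hg).
apply/nonuniformP; exists (h (g q)), (h q).
split; first by rewrite -permM mem_orbit_perm ?groupM.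
  exact: mem_orbit_perm.
case/orP: ab => /andP[qa qb].
  by rewrite -hb -gab !ltE // gab qa qb !orbT.
by rewrite -hb -gab !ltE // gab qa qb.
Qed.

(** Two distinct points with the same image must both lie in [B], which allows [B] to be recovered
    in [collapsible_count]. *)
Definition local_collapse B (f : {ffun P -> P}) :=
  [&& f \in poset_end P, [forall x, (x \notin B) ==> (f x == x)],
      [forall x in B, f x \in B] & ~~ injectiveb f].

Definition collapsible n B :=
  [&& #|B| <= n, [acts poset_aut P, on B | 'P] & [exists f, local_collapse B f]].

Lemma poset_endP (f : {ffun P -> P}) :
  reflect (forall x y, (x < y)%O -> (f x <= f y)%O) (f \in poset_end P).
Proof.
rewrite inE; apply: (iffP forallP) => [fP x y /ltW|fP x].
  by have /forallP/(_ y)/implyP := fP x.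
apply/forallP => y; apply/implyP; rewrite le_eqVlt => /predU1P[->//|].
exact: fP.
Qed.

(** The collapse sends [b] to its twin [a] and moves nothing else; the whole orbit is taken only for
    invariance. *)
Lemma collapsible_twins a b : a != b -> b \in orbit 'P (poset_aut P) a ->
  (forall p, uniform p [set a; b]) -> collapsible (width P) (orbit 'P (poset_aut P) a).
Proof.
move=> ab Gab unif; apply/and3P; split; [exact: card_orbit_aut | exact: acts_perm_orbit |].
have twin p := uniformP _ _ (unif p) a b (set21 _ _) (set22 _ _).
apply/existsP; exists [ffun x => if x == b then a else x]; apply/and4P; split.
- apply/poset_endP => x y xy; rewrite !ffunE.
  have [xb|_] := eqVneq x b; have [yb|_] := eqVneq y b; rewrite ?lexx // ltW //.
    by rewrite (twin y).2 -xb.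
  by rewrite (twin x).1 -yb.
- apply/forallP => x; apply/implyP; rewrite ffunE.
  by have [->|_] := eqVneq x b; rewrite ?Gab.
- apply/forall_inP => x Gx; rewrite ffunE.
  by have [_|_] := eqVneq x b; rewrite ?orbit_refl.
apply/injectiveP => /(_ a b); rewrite !ffunE eqxx (negbTE ab) => /(_ erefl) abE.
by rewrite abE eqxx in ab.
Qed.

Lemma collapsible_pair a b (A := orbit 'P (poset_aut P) a)
    (B := orbit 'P (poset_aut P) b) : (a < b)%O -> 1 < #|A| ->
    (forall p, p \notin A :|: B -> uniform p A && uniform p B) ->
  collapsible (2 * width P) (A :|: B).
Proof.
move=> ab A1 unif; apply/and3P; split.
- by rewrite mul2n -addnn (leq_trans (leq_card_setU _ _)) // leq_add ?card_orbit_aut.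
- apply: acts_perm => g c Gg; rewrite !inE -!apermE.
  by have /actsP -> // := acts_perm_orbit poset_aut_group a; have /actsP -> := acts_perm_orbit poset_aut_group b.
have antiA := @orbit_aut_not_lt a; have antiB := @orbit_aut_not_lt b.
(* A point [g b] below [q] in [A] would put [g a] below [q], although [A] is an antichain. So
   comparabilities between [A] and [B] go one way, and sending [A] to [a] and [B] to [b] preserves
   order. *)
have notBA p q : p \in B -> q \in A -> ~~ (p < q)%O.
  move=> /orbitP[g Gg <-] Aq; apply/negP => lt_q.
  have /negP[] := antiA (g a) q (mem_orbit_perm _ Gg) Aq.
  by apply: lt_trans lt_q; rewrite (poset_aut_lt Gg).
have aA : a \in A by exact: orbit_refl.
have bB : b \in B by exact: orbit_refl.
apply/existsP; exists [ffun x => if x \in A then a else if x \in B then b else x].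
apply/and4P; split.
- apply/poset_endP => x y xy; rewrite !ffunE.
  have [xA|xA] := boolP (x \in A).
    have [yA|yA] := boolP (y \in A); first by [].
    have [yB|yB] := boolP (y \in B); first exact: ltW.
    have /unif/andP[/uniformP/(_ a x aA xA)[_ ax] _] : y \notin A :|: B by rewrite inE negb_or yA.
    by rewrite ltW ?ax.
  have [xB|xB] := boolP (x \in B).
    have [yA|yA] := boolP (y \in A); first by have := notBA x y xB yA; rewrite xy.
    have [yB|yB] := boolP (y \in B); first by [].
    have /unif/andP[_ /uniformP/(_ b x bB xB)[_ bx]] : y \notin A :|: B by rewrite inE negb_or yA.
    by rewrite ltW ?bx.
  have /unif/andP[/uniformP uA /uniformP uB] : x \notin A :|: B by rewrite inE negb_or xA.
  have [yA|yA] := boolP (y \in A); first by rewrite ltW ?(uA a y aA yA).1.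
  have [yB|yB] := boolP (y \in B); first by rewrite ltW ?(uB b y bB yB).1.
  exact: ltW.
- apply/forallP => x; apply/implyP; rewrite ffunE !inE negb_or => /andP[xA xB].
  by rewrite (negbTE xA) (negbTE xB).
- apply/forall_inP => x; rewrite ffunE !inE.
  by case: (x \in A) => [_|/= ->]; rewrite ?aA ?bB ?orbT.
have /card_gt1P[c [e [cA eA /eqP ce]]] := A1.
by apply/injectiveP => /(_ c e); rewrite !ffunE cA eA => /(_ erefl).
Qed.

End Automorphisms.

(** * The order of a stabilizer *)

Lemma subn_boundary m : 0 < m < 9 -> m != 1 -> ~~ (1 < m < 8) -> 9 - m = 1.
Proof. lia. Qed.

Section StabilizerBound.
Variables (d : Order.disp_t) (P : finPOrderType d).
Implicit Types (x y z p q a b : P) (A B X Y Z : {set P}) (g h k : {perm P})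
  (H K : {group {perm P}}).
Local Notation G := (poset_aut_group P).

(* [B] itself need not be fixed: a collapsible set meets the union [S] of a
   maximal disjoint family of such sets, and [S], being [G]-invariant, then
   contains a whole [G]-orbit of [B], but perhaps not all of [B]. *)
Definition fixes_collapsibles H := forall B, collapsible 18 B ->
  exists2 b, b \in B & forall c h, c \in orbit 'P G b -> h \in H -> h c = c.

Lemma collapsible_leq m n B : m <= n -> collapsible m B -> collapsible n B.
Proof. by move=> mn /and3P[Bm GB cB]; rewrite /collapsible (leq_trans Bm mn) GB. Qed.

Hypothesis width9 : width P <= 9.

(** Otherwise two points of the orbit are twins, so their [G]-orbit is collapsible and hence fixed
    pointwise by [H]. *)
Lemma moved_nonuniform H x : H \subset G -> fixes_collapsibles H ->
  1 < #|orbit 'P H x| -> exists p, ~~ uniform p (orbit 'P H x).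
Proof.
move=> HG fixH /card_gt1P[a [b [xa xb ab]]].
apply/existsP; rewrite -negb_forall; apply/negP => /forallP unif.
have abH : b \in orbit 'P H a by move/orbit_eqP: xa => ->.
have abG : b \in orbit 'P G a by apply: subsetP abH; exact: orbit_aut_sub.
have /fixH[c ca fixc] : collapsible 18 (orbit 'P G a).
  apply: (@collapsible_leq (width P)); first by lia.
  apply: (collapsible_twins ab abG) => p; apply/uniformP => u v.
  have /uniformP unifp := unif p.
  by move=> /set2P[]-> /set2P[]->; apply: unifp.
have /orbitP[h Hh hab] := abH.
case/eqP: ab; by rewrite -hab /= apermE fixc // orbit_sym.
Qed.

Lemma pair_collapsible H x y (X := orbit 'P H x) (Y := orbit 'P H y) :
    H \subset G -> #|X| = 9 -> #|Y| = 9 -> ~~ uniform x Y ->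
    (forall z, z \notin X :|: Y -> uniform z X && uniform z Y) ->
  collapsible 18 (X :|: Y).
Proof.
move=> HG X9 Y9 xY unif.
(* Since 9 already bounds the size of [G]-orbits, a 9-point [H]-orbit is a full [G]-orbit. *)
have full z : #|orbit 'P H z| = 9 -> forall w, w \in orbit 'P H z -> orbit 'P G w = orbit 'P H z.
  move=> z9 w zw; apply/eqP; rewrite eq_sym eqEcard.
  rewrite z9 (leq_trans (card_orbit_aut w)) // andbT.
  by move/orbit_eqP: zw => <-; exact: orbit_aut_sub.
have xX : orbit 'P G x = X by apply: full => //; exact: orbit_refl.
have mono18 : 2 * width P <= 18 by lia.
have /nonuniformP[a [b [Ya _ /orP[]/andP[lt_xa _]]]] := xY.
  have aY : orbit 'P G a = Y by apply: full.
  have := collapsible_pair lt_xa; rewrite xX aY X9 => /(_ isT unif).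
  exact: collapsible_leq.
have aY : orbit 'P G a = Y by apply: full.
have := collapsible_pair lt_xa; rewrite xX aY Y9 setUC => /(_ isT) col.
apply: collapsible_leq mono18 _; apply: col => z /unif.
by rewrite andbC.
Qed.

Lemma card_sq_le_weight H : H \subset G -> fixes_collapsibles H ->
  #|H| ^ 2 <= orbits_weight H [set: P].
Proof.
have [n] := ubnP #|H|; elim: n H => // n IHn H leHn HG fixH.
have [/existsP[x0 x0_gt1]|] := boolP [exists x, 1 < #|orbit 'P H x|]; last first.
  rewrite negb_exists => /forallP fixed.
  suff -> : #|H| = 1 by apply: orbits_weight_gt0.
  apply/eqP; rewrite -trivg_card1 -subG1; apply/subsetP => h Hh.
  apply/set1P/permP => x; rewrite perm1.
  have := fixed x; rewrite -leqNgt => /card_le1_eqP; apply.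
    exact: orbit_refl.
  exact: mem_orbit_perm.
have card9 z : #|orbit 'P H z| <= 9.
  apply: leq_trans width9; apply: leq_trans (card_orbit_aut z).
  by apply: subset_leq_card; exact: orbit_aut_sub.
(* Linkage is symmetric, so the point to be fixed can be taken in the smaller of two linked
   orbits. *)
have [x [y [nyX le_XY]]] : exists x y, ~~ uniform y (orbit 'P H x) /\
    #|orbit 'P H x| <= #|orbit 'P H y|.
  have [p np] := moved_nonuniform HG fixH x0_gt1.
  have [le_XY|/ltnW le_YX] := leqP #|orbit 'P H x0| #|orbit 'P H p|; first by exists x0, p.
  by exists p, x0; split=> //; apply: contra np; apply: uniform_orbit_sym.
set X := orbit 'P H x in nyX le_XY *; set Y := orbit 'P H y in le_XY *.
have nxY : ~~ uniform x Y by apply: contra nyX; apply: uniform_orbit_sym.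
pose K := 'C_H[x | 'P]%G.
have KH : K \subset H by exact: subsetIl.
have KG : K \subset G := subset_trans KH HG.
have Kx k : k \in K -> k x = x by exact: stab_fix.
have notlt H' z : H' \subset G -> {in orbit 'P H' z &, forall a b, ~~ (a < b)%O}.
  move=> H'G a b za zb; apply: (@orbit_aut_not_lt _ _ z).
    by apply: subsetP za; exact: orbit_aut_sub.
  by apply: subsetP zb; exact: orbit_aut_sub.
have neq u v : ~~ uniform u (orbit 'P H v) -> orbit 'P H u != orbit 'P H v.
  apply: contra => /eqP uv; apply: uniform_antichain; first exact: notlt.
  by rewrite -uv orbit_refl.
have XY : X != Y by rewrite eq_sym; apply: neq.
have X_gt1 : 1 < #|X|.
  have /nonuniformP[a [b [Xa Xb ab]]] := nyX; apply/card_gt1P; exists a, b; split=> //.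
  by apply: contraTneq ab => ->; rewrite !andbN.
have leK : #|K| ^ 2 <= orbits_weight K [set: P].
  apply: IHn => //; last first.
    by move=> B /fixH[b Bb fixb]; exists b => // c h bc Kh; apply: fixb => //; apply: (subsetP KH).
  rewrite -ltnS; apply: leq_trans leHn; rewrite ltnS -(card_orbit_stab_perm H x).
  by rewrite -[ltnLHS]mul1n ltn_pmul2r // cardG_gt0.
have KonY : [acts K, on Y | 'P] by exact: acts_perm_sub KH (acts_perm_orbit H y).
have [A [AY KA /andP[A0 AltY]]] := uniform_split KG Kx KonY nxY.
have X0 : 0 < #|X| <= #|Y| by rewrite le_XY andbT ltnW.
have [side|] := boolP [|| #|Y| <= 8, #|X| <= 6 | 1 < #|A| < 8].
  by apply: (pair_step XY KA AY _ leK); apply: orbit_weight_pair; rewrite ?A0.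
(* Now [x] singles out one point [y0] of the 9-element orbit [Y], so the
   stabilizers of [x] and [y0] coincide and [X] has 9 points as well. *)
rewrite !negb_or => /and3P[Y8 X6 A18].
have Y9 : #|Y| = 9 by apply/eqP; rewrite eqn_leq card9 ltnNge.
have [y0 Yy0 Ky0] : exists2 y0, y0 \in Y & forall k, k \in K -> k y0 = y0.
  (* As [#|A|] is 1 or 8, either [A] or its complement in [Y] is a singleton. *)
  have [B [BY KB /eqP/cards1P[y0 BE]]] : exists B, [/\ B \subset Y, [acts K, on B | 'P] & #|B| = 1].
    have [A1|A1] := eqVneq #|A| 1; first by exists A.
    exists (Y :\: A); split; [exact: subsetDl | exact: acts_permD |].
    by rewrite cardsDS // Y9; apply: subn_boundary; rewrite // A0 -Y9.
  exists y0 => [|k Kk]; first by rewrite (subsetP BY) // BE inE.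
  by have /actsP/(_ k Kk y0) := KB; rewrite BE !inE eqxx => /eqP.
have YE : orbit 'P H y0 = Y by apply/orbit_eqP.
have X9 : #|X| = 9.
  apply/eqP; rewrite eqn_leq card9 -Y9 -YE.
  have KC : K \subset 'C_H[y0 | 'P]%G.
    by apply/subsetP => k Kk; rewrite inE (subsetP KH) //; apply/astab1P; exact: Ky0.
  rewrite -(leq_pmul2r (cardG_gt0 'C_H[y0 | 'P]%G)) card_orbit_stab_perm.
  by rewrite -(card_orbit_stab_perm H x) leq_mul2l subset_leq_card ?orbT.
(* Either a third orbit is linked to [X] or [Y] and is split by [K], which fixes both [x] and [y0],
   or [X :|: Y] is collapsible. *)
have [/existsP[z]|] := boolP [exists z, (z \notin X :|: Y) && ~~ (uniform z X && uniform z Y)].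
  rewrite inE negb_or negb_and => /andP[/andP[zX zY] nz]; set Z := orbit 'P H z.
  have XZ : X != Z by apply: contra zX => /eqP->; rewrite orbit_refl.
  have YZ : Y != Z by apply: contra zY => /eqP->; rewrite orbit_refl.
  have KonZ : [acts K, on Z | 'P] by exact: acts_perm_sub KH (acts_perm_orbit H z).
  have [B [BZ KB /andP[B0 BltZ]]] : exists B, [/\ B \subset Z, [acts K, on B | 'P] & 0 < #|B| < #|Z|].
    case/orP: nz => nz.
      apply: (uniform_split KG Kx KonZ).
      by apply: contra nz; apply: uniform_orbit_sym.
    apply: (uniform_split KG Ky0 KonZ).
    by apply: contra nz; rewrite -YE; apply: uniform_orbit_sym.
  apply: (@triple_step _ H x y0 z B) => //; rewrite ?YE //.
  rewrite -/X -/Z X9 Y9; apply: orbit_weight_triple; rewrite ?card9 //.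
  by rewrite B0.
rewrite negb_exists => /forallP unif.
have /fixH[b] : collapsible 18 (X :|: Y).
  apply: pair_collapsible => // z zXY.
  by have := unif z; rewrite zXY /= negbK.
(* The collapsible case is contradictory: [H] would fix pointwise an orbit with more than one
   point. *)
have fixed_orbit w : orbit 'P H w = orbit 'P H b -> 1 < #|orbit 'P H w| ->
    (forall c h, c \in orbit 'P G b -> h \in H -> h c = c) ->
    #|H| ^ 2 <= orbits_weight H [set: P].
  move=> wb; rewrite wb => /card_gt1P[u [v [bu bv uv]]] fixb.
  have fixu := fixb _ _ (subsetP (orbit_aut_sub b HG) _ _).
  move: bv; rewrite -(orbit_eqP bu) => /orbitP[h Hh huv].
  by case/eqP: uv; rewrite -huv /= apermE fixu.
rewrite inE => /orP[] bXY fixb.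
  by apply: (fixed_orbit x) => //; apply/esym/orbit_eqP.
by apply: (fixed_orbit y) => //; [apply/esym/orbit_eqP | rewrite -/Y Y9].
Qed.

End StabilizerBound.

(** * Counting endomorphisms *)

Lemma leq_expn2r n a b : a <= b -> a ^ n <= b ^ n.
Proof. by move=> ab; elim: n => // n IHn; rewrite !expnS leq_mul. Qed.

Section Counting.
Variables (d : Order.disp_t) (P : finPOrderType d).
Implicit Types (x y z p q a b : P) (A B X Y Z : {set P}) (g h k : {perm P})
  (H K : {group {perm P}}).
Local Notation G := (poset_aut_group P).

Lemma collapsible_count n (F : {set {set P}}) :
    trivIset F -> (forall B, B \in F -> collapsible n B) ->
  #|F| * #|poset_aut P| <= n`! * #|poset_end P|.
Proof.
move=> /trivIsetP trivF colF.
pose rho B := odflt [ffun x => x] [pick f | local_collapse B f].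
have rhoP B : B \in F -> local_collapse B (rho B).
  move=> /colF/and3P[_ _ /existsP[f fB]]; rewrite /rho.
  by case: pickP => // /(_ f); rewrite fB.
have rho_id B x : B \in F -> x \notin B -> rho B x = x.
  by move=> /rhoP/and4P[_ /forallP/(_ x)/implyP idB _ _] /idB/eqP.
have actB B g x : B \in F -> g \in G -> (g x \in B) = (x \in B).
  by move=> /colF/and3P[_ /actsP GB _] Gg; rewrite -apermE GB.
pose phi (u : {set P} * {perm P}) : {ffun P -> P} := [ffun x => rho u.1 (u.2 x)].
rewrite -cardsX; apply: (@leq_trans (n`! * #|phi @: setX F (poset_aut P)|)); last first.
  rewrite leq_mul2l; apply/orP; right; apply: subset_leq_card; apply/subsetP => f /imsetP[[B g]].
  move=> /setXP[/= FB Gg] {f}->; apply/poset_endP => x y xy; rewrite !ffunE /=.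
  have /and4P[/poset_endP rho_le _ _ _] := rhoP B FB.
  by apply: rho_le; rewrite (poset_aut_lt Gg).
apply: card_le_fiber => -[B g] /setXP[FB Gg].
set fib := [set u in _ | _].
have fibP u : u \in fib -> [/\ u.1 = B, u.2 \in G & {in [predC B], u.2 =1 g}].
  case: u => B' g'; rewrite inE => /andP[/setXP[/= FB' Gg'] /eqP/ffunP eq_phi].
  have {}eq_phi x : rho B' (g' x) = rho B (g x) by have := eq_phi x; rewrite !ffunE.
  have BB' : B' = B.
    (* Let [rho B'] identify [a = g' a'] and [b = g' b']. Both lie in [B'], so by disjointness
       [g a'] and [g b'] lie outside [B], where [rho B] is the identity; equality of the composites
       then forces [g a' = g b']. *)
    apply: contraTeq isT => neqB; have disj := trivF _ _ FB' FB neqB.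
    have /and4P[_ _ /forall_inP rhoB' /injectivePn[a [b ab rab]]] := rhoP B' FB'.
    have [[a' aE] [b' bE]] : (exists a', g' a' = a) /\ (exists b', g' b' = b).
      by split; [exists (g'^-1 a)%g | exists (g'^-1 b)%g]; rewrite permKV.
    have inB' c c' : c != c' -> rho B' c = rho B' c' -> c \in B'.
      move=> cc' rcc'; apply: contraNT cc' => cB'; apply/eqP.
      move: rcc'; rewrite rho_id // => cE; rewrite cE.
      have [/rhoB'|] := boolP (c' \in B'); last exact: rho_id.
      by rewrite -cE (negbTE cB').
    have aB' := inB' a b ab rab; have bB' := inB' b a (_ : b != a) (esym rab).
    rewrite eq_sym in ab; have {}bB' := bB' ab; rewrite eq_sym in ab.
    have gid c : g' c \in B' -> rho B (g c) = g c.
      rewrite actB // => cB'; apply: rho_id => //; rewrite actB //.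
      by rewrite (disjointFr disj).
    have /perm_inj a'b' : g a' = g b'.
      by rewrite -(gid a') ?aE // -(gid b') ?bE // -!eq_phi aE bE.
    by move: ab; rewrite -aE -bE a'b' eqxx.
  split=> // x; rewrite inE /= => xB.
  by have := eq_phi x; rewrite BB' !rho_id ?actB.
have -> : #|fib| = #|(fun u : {set P} * {perm P} => (g^-1 * u.2)%g) @: fib|.
  rewrite card_in_imset // => -[B1 g1] [B2 g2] /fibP[/= -> _ _] /fibP[/= -> _ _].
  by move=> /mulgI->.
have /and3P[Bn _ _] := colF B FB.
apply: leq_trans (leq_fact Bn); rewrite -card_perm; apply: subset_leq_card.
apply/subsetP => _ /imsetP[u /fibP[_ Gu ug] ->]; apply/subsetP => x.
rewrite inE permM; apply: contraR => xB; rewrite ug ?permKV //.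
by rewrite inE /= actB ?groupV.
Qed.

(** This is the height function, obtained as the strictly monotone function with the least sum of
    values; counting the points below [x] shows that one exists. *)
Lemma level_function : exists lev : P -> nat,
  (forall x y, (x < y)%O -> lev x < lev y) /\
  (forall x (k : nat), lev x = k.+1 -> exists2 y, (y < x)%O & lev y = k).
Proof.
pose mono (f : {ffun P -> 'I_#|P|.+1}) := [forall x, forall y, (x < y)%O ==> (f x < f y)].
pose f0 : {ffun P -> 'I_#|P|.+1} := [ffun x => inord #|[set y | (y < x)%O]|].
have mono0 : mono f0.
  apply/forallP => x; apply/forallP => y; apply/implyP => xy.
  rewrite !ffunE !inordK ?ltnS ?max_card //; apply: proper_card; apply/properP; split.
    by apply/subsetP => z; rewrite !inE => /lt_trans; apply.
  by exists x; rewrite !inE ?ltxx.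
have [f /forallP fmono fmin] := arg_minnP (fun f : {ffun P -> 'I_#|P|.+1} => \sum_x f x) mono0.
have fP x y : (x < y)%O -> f x < f y.
  by have /forallP/(_ y)/implyP := fmono x.
exists (fun x => nat_of_ord (f x)); split=> // x k fx.
have [/exists_inP[y yx /eqP fy]|] := boolP [exists (y | (y < x)%O), f y == k :> nat].
  by exists y.
rewrite negb_exists_in => /forall_inP no_below.
(* Lowering [x] by one level would contradict the minimality of the sum. *)
pose f' := [ffun z => if z == x then inord k else f z] : {ffun P -> 'I_#|P|.+1}.
have kP : k < #|P|.+1 by have := ltn_ord (f x); rewrite fx => /ltnW.
have f'mono : mono f'.
  apply/forallP => y; apply/forallP => z; apply/implyP => yz; rewrite !ffunE.
  have [yx|_] := eqVneq y x; have [zx|_] := eqVneq z x.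
  - by move: yz; rewrite yx zx ltxx.
  - by rewrite inordK // ltnW // -fx -yx fP.
  - rewrite inordK // ltn_neqAle no_below -?zx //=.
    by rewrite -ltnS -fx -zx fP.
  - exact: fP.
have := fmin f' f'mono; rewrite leqNgt => /negP[].
rewrite (bigD1 x) //= [X in _ < X](bigD1 x) //= ffunE eqxx inordK // fx.
rewrite (eq_bigr (fun i => nat_of_ord (f i))) ?ltn_add2r // => i ix.
by rewrite ffunE (negbTE ix).
Qed.

(** The subsets [A] range over the points below the top level. The top level is an antichain, which
    accounts for the factor [2 ^ width P]. *)
Lemma card_poset_end_ge : 2 ^ #|P| <= 2 ^ width P * #|poset_end P|.
Proof.
have [lev [lev_lt lev_pred]] := level_function.
have [/card0_eq P0|/card_gt0P[x0 _]] := posnP #|P|.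
  have -> : #|P| = 0 by apply: eq_card0.
  rewrite muln_gt0 expn_gt0; apply/card_gt0P; exists [ffun x => x].
  by apply/poset_endP => x; have := P0 x; rewrite !inE.
pose h := \max_x lev x.
have lev_le x : lev x <= h by apply: leq_bigmax.
have [xh xhE] : exists x, lev x = h.
  have P_gt0 : 0 < #|P| by apply/card_gt0P; exists x0.
  by have [x hx] := bigop.eq_bigmax lev P_gt0; exists x; rewrite /h hx.
(* Descending one level at a time from a point of level [h] yields the chain. *)
have [c cS] : exists c : nat -> P, forall i, i < h -> (c i < c i.+1)%O.
  suff [c [_ cS]] : exists c : nat -> P, c h = xh /\ forall i, i < h -> (c i < c i.+1)%O by exists c.
  elim: h xh xhE {lev_le} => [|n IHn] x xE; first by exists (fun => x).
  have [y yx yE] := lev_pred x n xE; have [c [cn cS]] := IHn y yE.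
  exists (fun i => if i == n.+1 then x else c i); rewrite eqxx; split=> // i.
  rewrite ltnS eqSS => le_in; rewrite ltn_eqF // ?ltnS //.
  by case: eqVneq le_in => [->|ni le_in]; [rewrite cn | apply: cS; rewrite ltn_neqAle ni].
have c_lt i j : i < j -> j <= h -> (c i < c j)%O.
  elim: j => // j IHj; rewrite ltnS leq_eqVlt => /predU1P[-> /cS //|ij jh].
  exact: lt_trans (IHj ij (ltnW jh)) (cS j jh).
have c_le i j : i <= j -> j <= h -> (c i <= c j)%O.
  by rewrite leq_eqVlt => /predU1P[->//|ij jh]; rewrite ltW ?c_lt.
have c_inj i j : i <= h -> j <= h -> c i = c j -> i = j.
  move=> ih jh cij; apply/eqP; case: ltngtP => // lt_ij.
    by have := c_lt _ _ lt_ij jh; rewrite cij ltxx.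
  by have := c_lt _ _ lt_ij ih; rewrite cij ltxx.
pose L := [set x | lev x < h].
have <- : #|L| + #|~: L| = #|P| by exact: cardsC.
have topL : #|~: L| <= width P.
  apply: card_antichain => a b; rewrite !inE -!leqNgt => ha hb.
  apply/negP => /lev_lt; apply/negP; rewrite -leqNgt.
  exact: leq_trans (lev_le b) ha.
rewrite expnD mulnC leq_mul //; first by rewrite leq_exp2l.
rewrite -card_powerset.
pose shift (A : {set P}) : {ffun P -> P} := [ffun x => c (lev x + (x \in A))].
have shift_le A x : A \in powerset L -> lev x + (x \in A) <= h.
  rewrite inE => /subsetP AL; case: (boolP (x \in A)) => [/AL|_]; last by rewrite addn0.
  by rewrite inE addn1.
rewrite -(@card_in_imset _ _ shift); last first.
  move=> A B LA LB /ffunP eqAB; apply/setP => x; have := eqAB x; rewrite !ffunE.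
  by move=> /c_inj; rewrite !shift_le // => /(_ isT isT)/addnI; do 2! case: (x \in _).
apply: subset_leq_card; apply/subsetP => _ /imsetP[A LA ->].
(* The level rises by at least 1 from [x] to [y], which absorbs the shift by at most 1 at [x]. *)
apply/poset_endP => x y /lev_lt xy; rewrite !ffunE; apply: c_le; last exact: shift_le.
apply: leq_trans (leq_addr _ _); apply: leq_trans xy.
by case: (x \in A); rewrite ?addn1 ?addn0.
Qed.

(** Fixing the points of [S] one by one costs an orbit, hence at most [width P], each time. *)
Lemma card_pointwise_stab (S : {set P}) :
  #|G| <= width P ^ #|S| * #|'C_G(S | 'P)%g|.
Proof.
have [n] := ubnP #|S|; elim: n S => // n IHn S.
have [->|[x Sx]] := set_0Vmem S.
  rewrite cards0 mul1n => _; apply: subset_leq_card; apply/subsetP => g Gg.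
  by rewrite inE Gg; apply/astabP => x; rewrite inE.
rewrite (cardsD1 x) Sx ltnS => /IHn/leq_trans; apply.
rewrite expnS -mulnA mulnCA leq_mul2l; apply/orP; right.
rewrite -(card_orbit_stab_perm 'C_G(S :\ x | 'P)%G x); apply: leq_mul.
  apply: leq_trans (card_orbit_aut x); apply: subset_leq_card.
  by apply: orbit_aut_sub; exact: subsetIl.
apply: subset_leq_card; apply/subsetP => g /setIP[/setIP[Gg gS] gx].
apply/setIP; split=> //; apply/astabP => y Sy; have [->|yx] := eqVneq y x; first exact: astab1P.
by apply: (astabP gS); rewrite !inE yx.
Qed.

Lemma max_disjoint_collapsibles n : exists F : {set {set P}},
  [/\ trivIset F, forall B, B \in F -> collapsible n B &
      forall B, collapsible n B -> ~~ [disjoint B & cover F]].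
Proof.
pose good (F : {set {set P}}) := trivIset F && [forall B in F, collapsible n B].
have good0 : good set0.
  by rewrite /good; apply/andP; split; [apply/trivIsetP => A | apply/forall_inP => A]; rewrite inE.
have [F /andP[trivF /forall_inP colF] maxF] :=
  arg_maxnP (fun F : {set {set P}} => #|F|) good0.
(* Nonemptiness ensures that adding a disjoint collapsible set really enlarges the family. *)
have neq0 B : collapsible n B -> B != set0.
  move=> /and3P[_ _ /existsP[f /and4P[_ /forallP idB _ /injectivePn[a [b ab fab]]]]].
  apply: contra_neq ab => B0; move: fab.
  by rewrite !(eqP (implyP (idB _) _)) // B0 inE.
exists F; split=> // B colB; apply/negP => disjB.
have F0 : set0 \notin F by apply/negP => /colF/neq0/eqP.
have disjBF : {in F, forall A, [disjoint B & A]}.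
  by move=> A FA; apply: disjointWr disjB; exact: bigcup_sup.
have [trivBF BF] := trivIsetU1 disjBF trivF F0.
have /maxF : good (B |: F).
  rewrite /good trivBF; apply/forall_inP => A /setU1P[->//|]; exact: colF.
by rewrite cardsU1 BF add1n /= ltnn.
Qed.

Lemma orbits_weight_le_pow H : H \subset G -> width P <= 9 ->
  64 ^ (#|P| %/ 9) * orbits_weight H [set: P] <= 63 ^ (#|P| %/ 9) * 4 ^ #|P|.
Proof.
move=> HG width9; set m := #|P| %/ 9; pose O := orbit 'P H @: [set: P].
have O9 A : A \in O -> 0 < #|A| <= 9.
  move=> /imsetP[x _ ->]; apply/andP; split.
    by apply/card_gt0P; exists x; exact: orbit_refl.
  apply: leq_trans (leq_trans (card_orbit_aut x) width9).
  exact: subset_leq_card (orbit_aut_sub x HG).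
have cardP : #|P| = \sum_(A in O) #|A|.
  rewrite -cardsT; apply/card_partition/orbit_partition.
  by apply: acts_perm => h a; rewrite !inE.
(* Orbits have at most 9 points, so there are at least [#|P| %/ 9] of them. *)
have mO : m <= #|O|.
  rewrite -(@leq_pmul2r 9) // (leq_trans (leq_trunc_div _ _)) // cardP -sum_nat_const.
  by apply: leq_sum => A /O9/andP[].
have : 64 ^ #|O| * orbits_weight H [set: P] <= 63 ^ #|O| * 4 ^ #|P|.
  rewrite cardP (expn_sum 4) -!prod_nat_const -!big_split /=.
  by apply: leq_prod => A /O9; exact: orbit_weight_le_pow4.
rewrite -(subnK mO) !expnD -!mulnA => le_O.
rewrite -(@leq_pmul2l (64 ^ (#|O| - m))) ?expn_gt0 //.
by apply: leq_trans le_O _; rewrite leq_mul2r leq_expn2r // orbT.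
Qed.

(** The alternatives are at least [r] disjoint collapsible sets, or fewer, whose union [S] then has
    at most [18 * r] points and can be fixed pointwise. *)
Lemma aut_end_bound r : width P <= 9 ->
  r * #|poset_aut P| <= 18`! * #|poset_end P| \/
  64 ^ (#|P| %/ 9) * #|poset_aut P| ^ 2 <=
    63 ^ (#|P| %/ 9) * (9 ^ (18 * r) * (2 ^ 9 * #|poset_end P|)) ^ 2.
Proof.
move=> width9; have [F [trivF colF maxF]] := max_disjoint_collapsibles 18.
have [rF|/ltnW Fr] := leqP r #|F|.
  by left; apply: leq_trans (collapsible_count trivF colF); rewrite leq_mul2r rF orbT.
right; pose S := cover F; pose H := 'C_G(S | 'P)%G.
have cardS : #|S| <= 18 * r.
  apply: leq_trans (leq_card_cover F) _.
  apply: (@leq_trans (\sum_(B in F) 18)).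
    by apply: leq_sum => B /colF/and3P[].
  by rewrite sum_nat_const mulnC leq_mul2l Fr orbT.
have HG : H \subset G by exact: subsetIl.
have fixH : fixes_collapsibles H.
  move=> B /maxF; rewrite -setI_eq0 => /set0Pn[b /setIP[Bb Sb]]; exists b => // c h bc.
  move=> /setIP[_ /astabP]; apply; move: Sb => /bigcupP[A FA Ab].
  apply/bigcupP; exists A => //; have /and3P[_ GA _] := colF A FA.
  by apply: subsetP bc; rewrite acts_sub_orbit.
have leH := card_sq_le_weight width9 HG fixH.
have leGH : #|poset_aut P| <= 9 ^ (18 * r) * #|H|.
  apply: leq_trans (card_pointwise_stab S) _; rewrite leq_mul2r; apply/orP; right.
  by apply: leq_trans (leq_expn2r _ width9) _; rewrite leq_exp2l.
have leE : 2 ^ #|P| <= 2 ^ 9 * #|poset_end P|.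
  by apply: leq_trans card_poset_end_ge _; rewrite leq_mul2r leq_exp2l // width9 orbT.
apply: (@leq_trans ((9 ^ (18 * r)) ^ 2 * (64 ^ (#|P| %/ 9) * #|H| ^ 2))).
  by rewrite mulnCA leq_mul2l -expnMn leq_sqr leGH orbT.
rewrite expnMn [leqRHS]mulnCA leq_mul2l; apply/orP; right.
apply: (@leq_trans (64 ^ (#|P| %/ 9) * orbits_weight H [set: P])).
  by rewrite leq_mul2l leH orbT.
apply: leq_trans (orbits_weight_le_pow HG width9) _.
(* [4 ^ #|P|] is the square of [2 ^ #|P|], which [leE] bounds. *)
by rewrite leq_mul2l -(expnM 2 2) mulnC expnM leq_sqr leE orbT.
Qed.

End Counting.

(** * The limit *)

From mathcomp Require Import all_classical all_reals all_analysis.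

Import Order.TTheory GRing.Theory Num.Theory.
Import numFieldNormedType.Exports.
Local Open Scope classical_set_scope.
Local Open Scope ring_scope.

Lemma is_max_finite (R : realType) (A : set R) (s : seq R) :
  A !=set0 -> (forall r, A r -> r \in s) -> exists m, is_max A m.
Proof.
move=> [r0 Ar0] As.
have index_lt r : A r -> (index r s < size s)%N by move=> /As; rewrite index_mem.
have nthA r : A r -> s`_(index r s) = r by move=> /As; exact: nth_index.
pose i0 := Ordinal (index_lt r0 Ar0).
have Ai0 : `[< A s`_i0 >] by apply/asboolP; rewrite nthA.
case: (@arg_maxP _ _ _ i0 (fun i : 'I_(size s) => `[< A s`_i >]) (fun i => s`_i) Ai0).
move=> i /asboolP Ai maxi; exists s`_i; split=> // r Ar.
have := maxi (Ordinal (index_lt r Ar)); rewrite /= nthA //; apply.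
exact/asboolP.
Qed.

Lemma aut_end_ratios_has_max (R : realType) (n : nat) :
  exists m, is_max (aut_end_ratios R 9 n) m.
Proof.
(* Numerators are at most [n]! and denominators at most [n ^ n], so only finitely many ratios occur;
   the chain ['I_n] shows that there is one. *)
apply: (@is_max_finite _ _ [seq a%:R / b%:R | a <- iota 0 n`!.+1, b <- iota 0 (n ^ n).+1]).
  exists (aut_end_ratio R 'I_n); exists _, 'I_n; split=> //; last exact: card_ord.
  apply/bigmax_leqP => A /forall_inP antiA.
  apply: (@leq_trans 1%N) => //; apply/card_le1_eqP => i j Ai Aj; apply/eqP.
  have /forall_inP/(_ i Ai)/implyP := antiA j Aj.
  by case: eqVneq => // _ /(_ isT); rewrite /Order.comparable le_total.
move=> _ [d [P [_ Pn ->]]]; apply/allpairsP; exists (#|poset_aut P|, #|poset_end P|).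
rewrite -Pn; split=> //; rewrite mem_iota add0n ltnS leq0n.
  rewrite -cardsT -card_perm; apply: subset_leq_card; apply/fintype.subsetP => g _.
  by apply/fintype.subsetP => x; rewrite inE.
by rewrite -card_ffun max_card.
Qed.

Lemma aut_end_ratio_bound (R : realType) (d : Order.disp_t) (P : finPOrderType d)
    (r : nat) : (width P <= 9)%N -> (0 < r)%N ->
  aut_end_ratio R P <= (18`!)%:R / r%:R \/
  aut_end_ratio R P ^+ 2 <=
    ((9 ^ (18 * r) * 2 ^ 9) ^ 2)%:R * (63 / 64) ^+ (#|P| %/ 9).
Proof.
move=> width9 r0.
have e0 : 0 < #|poset_end P|%:R :> R.
  rewrite ltr0n; apply/card_gt0P; exists [ffun x => x].
  by apply/poset_endP => x y; rewrite !ffunE => /ltW.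
rewrite /aut_end_ratio.
have [le_r|le_q] := aut_end_bound r width9; [left|right].
  rewrite ler_pdivrMr // mulrAC ler_pdivlMr ?ltr0n //.
  by rewrite -!natrM ler_nat mulnC.
rewrite !expr_div_n mulrA ler_pdivrMr ?exprn_gt0 // mulrAC ler_pdivlMr ?exprn_gt0 ?ltr0n //.
rewrite -!natrX -!natrM ler_nat.
rewrite mulnC; apply: leq_trans le_q _.
by rewrite (mulnA (9 ^ (18 * r))%N) (expnMn (9 ^ (18 * r) * 2 ^ 9)%N) mulnCA -[leqRHS]mulnA.
Qed.

Theorem theorem10p3 (R : realType) :
  exists M : nat -> R,
    (forall n : nat, is_max (aut_end_ratios R 9 n) (M n)) /\
    M n @[n --> \oo] --> (0 : R).
Proof.
have [M maxM] := choice (aut_end_ratios_has_max R).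
exists M; split=> //; apply/cvgrPdist_lt => e e0.
(* Choosing [r] from [e] alone settles the first alternative and makes the factor [C] in the second
   independent of [n]. *)
pose r := (Num.truncn ((18`!)%:R / e)).+1.
have re : (18`!)%:R / r%:R < e.
  rewrite ltr_pdivrMr ?ltr0n // mulrC -ltr_pdivrMr //.
  exact: truncnS_gt.
pose C : R := ((9 ^ (18 * r) * 2 ^ 9) ^ 2)%:R.
have C0 : 0 < C by rewrite ltr0n !(expn_gt0, muln_gt0).
have : (63 / 64 : R) ^+ n @[n --> \oo] --> 0.
  by apply: cvg_expr; rewrite ger0_norm ?divr_ge0 // ltr_pdivrMr // mul1r ltr_nat.
move=> /cvgrPdist_lt/(_ (e ^+ 2 / C)); rewrite divr_gt0 ?exprn_gt0 // => /(_ isT)[N _ lt_N].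
(* The exponent of [63 / 64] is [n %/ 9], which must reach [N]. *)
exists (9 * N)%N => // n /= le_n.
have [[d [P [width9 Pn ->]]] _] := maxM n.
have ratio_ge0 : 0 <= aut_end_ratio R P by rewrite divr_ge0.
rewrite sub0r normrN ger0_norm //.
have [le_r|le_q] := @aut_end_ratio_bound R d P r width9 isT; first exact: le_lt_trans le_r re.
rewrite -(@ltr_pXn2r _ 2) ?nnegrE ?(ltW e0) //.
apply: le_lt_trans le_q _; rewrite mulrC -ltr_pdivlMr //.
have := lt_N (#|P| %/ 9)%N; rewrite /= sub0r normrN ger0_norm ?exprn_ge0 //.
by apply; rewrite Pn leq_divRL // mulnC.
Qed.
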